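(* Let $M_n$ denote the $n$th Motzkin number. The set $\{n \in \mathbb{N} : M_n \equiv 0 \pmod 3\}$ has asymptotic density $1$.
   Context: $\mathbb{N} = \{0,1,2,\dots\}$. The Motzkin numbers are $M_n = \sum_{k \geq 0} \binom{n}{2k} C_k$ for $n \in \mathbb{N}$, where $C_k = \frac{1}{k+1}\binom{2k}{k}$ is the $k$th Catalan number. The asymptotic density of a subset $A \subseteq \mathbb{N}$ is $\lim_{N\to\infty} \frac{1}{N}\#\{n \in A : n \leq N\}$, if this limit exists. *)

(* Defs.v *)
From HB Require Import structures.
From mathcomp Require Import all_boot all_order all_algebra.
From mathcomp Require Import all_classical all_reals topology normedtype sequences.
Set Implicit Arguments.
Unset Strict Implicit.
Unset Printing Implicit Defensive.
Import Order.TTheory GRing.Theory Num.Theory.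
Import numFieldNormedType.Exports.

(* The Euclidean quotient is exact, see [mul_catalan]. *)
Definition catalan (k : nat) : nat := 'C(2 * k, k) %/ k.+1.

Lemma mul_catalan k : k.+1 * catalan k = 'C(2 * k, k).
Proof.
have E : k.+1 * ('C(2 * k, k) - 'C(2 * k, k.+1)) = 'C(2 * k, k).
  rewrite mulnBr mul_bin_left mul2n -addnn addnK mulSn addnK //.
by rewrite /catalan mulnC divnK // -E dvdn_mulr.
Qed.

(* The sum over all k >= 0 is cut at k <= n; since 'C(n, 2 * k) = 0 for
   2 * k > n, no nonzero term is lost, see [motzkin_widen]. *)
Definition motzkin (n : nat) : nat :=
  \sum_(0 <= k < n.+1) 'C(n, 2 * k) * catalan k.

Lemma motzkin_widen n m : n < m ->
  \sum_(0 <= k < m) 'C(n, 2 * k) * catalan k = motzkin n.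
Proof.
move=> nm; rewrite /motzkin (@big_cat_nat _ _ _ n.+1) //=.
rewrite [X in _ + X]big_nat_cond [X in _ + X]big1 ?addn0 // => k /andP[/andP[nk _] _].
by rewrite bin_small // mul2n -addnn (leq_trans nk) // leq_addr.
Qed.

Local Open Scope classical_set_scope.
Local Open Scope ring_scope.

(* The count ranges over 0 <= n <= N; the term at N = 0 is 0 (as 0^-1 = 0)
   and does not affect the limit. *)
Definition has_asymptotic_density (R : realType) (A : set nat) (d : R) : Prop :=
  (N%:R^-1 * #|[pred n : 'I_N.+1 | (n : nat) \in A]|%:R : R) @[N --> \oo] --> d.

(* Main.v *)
(* Touchard's identity C_{n+1} = sum_k 'C(n, 2k) 2^(n-2k) C_k, read modulo 3
   with 2 = -1, gives M_n = (-1)^n C_{n+1} mod 3. As (m+1) C_m = 'C(2m, m) and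
   (2m+1) C_m = 'C(2m+1, m), where m+1 and 2m+1 are not both divisible by 3, a
   C_m prime to 3 forces 'C(2m, m) or 'C(2m+1, m) to be prime to 3. By Lucas'
   theorem each of these happens for exactly 2^k of the m < 3^k, so at most
   2^(k+1) of the n < 3^k - 1 have M_n prime to 3. *)
Require Import Defs.
From mathcomp Require Import all_boot all_order all_algebra.
From mathcomp Require Import all_classical all_reals topology normedtype sequences.
From mathcomp Require Import zify ring lra.
Import Order.TTheory GRing.Theory Num.Theory.
Import numFieldNormedType.Exports.

(** * Binomial identities from polynomial coefficients *)

Lemma coef_1Xn (R : comNzRingType) (n k : nat) :
  (((1 + 'X) ^+ n : {poly R})`_k = 'C(n, k)%:R)%R.
Proof.
elim: n k => [|n IHn] [|k]; rewrite ?expr0 ?coef1 ?bin0n //.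
  by rewrite exprS mulrDl mul1r coefD coefXM /= IHn addr0 !bin0.
by rewrite exprS mulrDl mul1r coefD coefXM /= !IHn binS natrD.
Qed.

Lemma coef_1Xmn (R : comNzRingType) (m n k : nat) : 0 < m ->
  (((1 + 'X^m) ^+ n : {poly R})`_k = if (m %| k)%N then 'C(n, k %/ m)%:R else 0)%R.
Proof.
move=> m0; have -> : (1 + 'X^m : {poly R})%R = ((1 + 'X) \Po 'X^m)%R.
  by rewrite comp_polyD comp_polyX comp_polyC.
by rewrite -rmorphXn /= coef_comp_poly_Xn // coef_1Xn.
Qed.

Lemma sum_even (F : nat -> nat) (m : nat) :
  \sum_(0 <= j < 2 * m | ~~ odd j) F j = \sum_(0 <= k < m) F (2 * k).
Proof.
elim: m => [|m IHm]; first by rewrite muln0 !big_nil.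
rewrite mulnS add2n !big_nat_recr //= big_mkcond big_nat_recr // big_nat_recr //=.
by rewrite -big_mkcond IHm oddM /= addn0.
Qed.

(* Compares coefficients of X^(n + 2i) in (1 + X)^(2n) = (2X + (1 + X^2))^n. *)
Lemma sum_bin_central (n i : nat) :
  \sum_(0 <= k < n.+1) 'C(n, 2 * k) * 2 ^ (n - 2 * k) * 'C(2 * k, k + i)
  = 'C(2 * n, n + 2 * i).
Proof.
pose F j := 'C(n, j) * 2 ^ (n - j) * 'C(j, j./2 + i).
transitivity (\sum_(0 <= j < n.+1 | ~~ odd j) F j).
  transitivity (\sum_(0 <= j < 2 * n.+1 | ~~ odd j) F j).
    by rewrite sum_even; apply: eq_bigr => k _; rewrite /F mul2n doubleK.
  rewrite (big_cat_nat (n := n.+1)) //= ?leq_pmull //.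
  rewrite [X in _ + X]big_nat_cond [X in _ + X]big1 ?addn0 // => j.
  case/andP=> /andP[nj _] _.
  by rewrite /F bin_small.
have E : ((1 + 'X) ^+ (2 * n) = ('X *+ 2 + (1 + 'X^2)) ^+ n :> {poly int})%R.
  by rewrite exprM; congr (_ ^+ _)%R; ring.
apply/eqP; rewrite -(eqr_nat int) -coef_1Xn E exprDn coef_sum natr_sum.
rewrite big_mkord big_mkcond /=; apply/eqP; apply: eq_bigr => j _.
have jn : j <= n by rewrite -ltnS.
(* Term [j] reduces to the coefficient of X^(2i + j) in (1 + X^2)^j, which vanishes for odd [j]. *)
rewrite exprMn_n mulrnAl -mulrnA coefMn coefXnM coef_1Xmn //.
have -> : (n + 2 * i < n - j)%N = false by lia.
have -> : n + 2 * i - (n - j) = 2 * i + j by lia.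
rewrite dvdn_addr ?dvdn_mulr // dvdn2; case: ifP => ej; last by rewrite mul0rn.
rewrite /F -divn2 mulnC; have -> : (2 * i + j) %/ 2 = j %/ 2 + i by lia.
by rewrite natrM mulr_natr [(2 ^ _ * _)%N]mulnC.
Qed.

(** Over F_p, (1 + X)^(pa + r) = (1 + X^p)^a (1 + X)^r by Frobenius; the coefficient of X^(pb + s)
    is then compared on both sides. *)
Lemma lucas_mod (p a b r s : nat) : prime p -> r < p -> s < p ->
  'C(p * a + r, p * b + s) = 'C(a, b) * 'C(r, s) %[mod p].
Proof.
move=> p_pr rp sp.
have pF := pchar_Fp p_pr.
suff : ('C(p * a + r, p * b + s)%:R = ('C(a, b) * 'C(r, s))%:R :> 'F_p)%R.
  by move/(congr1 val); rewrite /= !val_Fp_nat.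
have E : ((1 + 'X) ^+ (p * a + r) = (1 + 'X^p) ^+ a * (1 + 'X) ^+ r :> {poly 'F_p})%R.
  by rewrite exprD exprM exprDn_pchar ?expr1n // pnatE // pchar_poly.
rewrite -coef_1Xn E coefMr.
have sm : s < (p * b + s).+1 by rewrite ltnS leq_addl.
rewrite (bigD1 (Ordinal sm)) //= big1 ?addr0 => [|j js].
  rewrite addnK coef_1Xmn ?prime_gt0 // dvdn_mulr // mulKn ?prime_gt0 //.
  by rewrite coef_1Xn natrM.
rewrite coef_1Xmn ?prime_gt0 // coef_1Xn.
(* For j <> s, either j > r and the second factor vanishes, or j <= r < p and divisibility of pb + s
   - j by p would force j = s. *)
case: (ltnP r j) => rj; first by rewrite (bin_small rj) mulr0.
rewrite ifN ?mul0r //; apply: contra js => dv.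
have jp : j < p by apply: leq_ltn_trans rp.
apply/eqP/val_inj => /=.
have : b * p + s = j %[mod p] by apply/eqP; rewrite mulnC eqn_mod_dvd // -ltnS.
by rewrite modnMDl !modn_small.
Qed.

(** * Touchard's identity and its reduction modulo 3 *)

Lemma catalan_bin k : catalan k + 'C(2 * k, k.+1) = 'C(2 * k, k).
Proof.
apply/eqP; rewrite -(eqn_pmul2l (ltn0Sn k)) mulnDr mul_catalan mul_bin_left.
by rewrite mul2n -addnn addnK mulSn.
Qed.

(** Pascal's rule expands row 2n + 2 down to row 2n, and the symmetry of row 2n + 1 cancels the
    surplus terms. *)
Lemma catalanS_bin n : catalan n.+1 + 'C(2 * n, n.+2) = 'C(2 * n, n).
Proof.
have := catalan_bin n.+1; rewrite mulnS add2n !binS.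
have -> : 'C(2 * n, n.+1) + 'C(2 * n, n) = 'C((2 * n).+1, n.+1) by [].
have : 'C((2 * n).+1, n.+1) = 'C((2 * n).+1, n).
  by rewrite -bin_sub; [congr 'C(_, _)|]; lia.
by move=> <-; rewrite binS; lia.
Qed.

(** As C_k = 'C(2k, k) - 'C(2k, k+1), the sum is the difference of the cases i = 0 and i = 1 of
    [sum_bin_central]. *)
Lemma touchard n :
  \sum_(0 <= k < n.+1) 'C(n, 2 * k) * 2 ^ (n - 2 * k) * catalan k = catalan n.+1.
Proof.
apply/eqP; rewrite -(eqn_add2r 'C(2 * n, n.+2)) catalanS_bin; apply/eqP.
have := sum_bin_central n 1; have := sum_bin_central n 0.
rewrite muln0 muln1 addn0 addn2 => <- <-; rewrite -big_split /=.
by apply: eq_bigr => k _; rewrite -mulnDr addn1 catalan_bin addn0.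
Qed.

Lemma dvd3_motzkin n : (3 %| motzkin n) = (3 %| catalan n.+1).
Proof.
have pF := pchar_Fp (isT : prime 3).
rewrite !(dvdn_pcharf pF) -touchard /motzkin !natr_sum.
(* Multiplying by the regular element (-1)^n makes the two sums agree term by term, as (-1)^n 2^(n -
   2k) = (-1)^(2(n - k)) = 1 in F_3. *)
rewrite -[RHS](mulrI_eq0 _ (@lregX _ _ n (lregN (@lreg1 'F_3)))) mulr_sumr.
congr (_ == 0)%R.
apply: eq_big_nat => k /andP[_ kn].
case: (leqP (2 * k) n) => kn2; last by rewrite bin_small // !mul0n mulr0.
rewrite !natrM natrX mulrA [(_ * (_ * _))%R]mulrCA.
have -> : (2%:R = -1 :> 'F_3)%R by apply/val_inj.
rewrite -exprD; have -> : n + (n - 2 * k) = 2 * (n - k) by lia.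
by rewrite exprM sqrrN expr1n expr1n mulr1.
Qed.

(** * Central binomials modulo 3 and ternary digits *)

Definition nz_even m := ~~ (3 %| 'C(2 * m, m)).
Definition nz_odd m := ~~ (3 %| 'C((2 * m).+1, m)).

Lemma ndvd3_catalan m : ~~ (3 %| catalan m) -> nz_even m || nz_odd m.
Proof.
move=> nz; rewrite -negb_and; apply/negP => /andP[].
rewrite -mul_catalan Euclid_dvdM // (negPf nz) orbF => m3.
have -> : 'C((2 * m).+1, m) = (2 * m).+1 * catalan m.
  apply/eqP; rewrite -(eqn_pmul2l (ltn0Sn m)) mulnCA mul_catalan.
  have := mul_bin_down (2 * m).+1 m; rewrite /= => ->.
  by apply/eqP; congr (_ * _); lia.
by rewrite Euclid_dvdM // (negPf nz) orbF; lia.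
Qed.

Lemma dvd3_lucas a b r s : r < 3 -> s < 3 ->
  (3 %| 'C(3 * a + r, 3 * b + s)) = (3 %| 'C(a, b) * 'C(r, s)).
Proof. by move=> r3 s3; rewrite /dvdn lucas_mod. Qed.

(** Lucas' theorem splits off the last ternary digit of m. Digits 0 and 1 give 'C(0, 0) and 'C(2,
    1), prime to 3; digit 2 gives 'C(1, 2) = 0. *)
Lemma nz_even0 q : nz_even (3 * q) = nz_even q.
Proof.
rewrite /nz_even; have := @dvd3_lucas (2 * q) q 0 0 isT isT.
by rewrite !addn0 muln1 mulnCA => ->.
Qed.

Lemma nz_even1 q : nz_even (3 * q + 1) = nz_even q.
Proof.
rewrite /nz_even; have -> : 2 * (3 * q + 1) = 3 * (2 * q) + 2 by lia.
by rewrite dvd3_lucas // Euclid_dvdM // orbF.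
Qed.

Lemma nz_even2 q : nz_even (3 * q + 2) = false.
Proof.
rewrite /nz_even; have -> : 2 * (3 * q + 2) = 3 * (2 * q).+1 + 1 by lia.
by rewrite dvd3_lucas // muln0.
Qed.

(** In 2m + 1 the digit 0 of m produces no carry, so the even row 2q remains; digit 1 gives 'C(0, 1)
    = 0; digit 2 carries 1 and leaves the odd row 2q + 1. *)
Lemma nz_odd0 q : nz_odd (3 * q) = nz_even q.
Proof.
rewrite /nz_odd /nz_even; have -> : (2 * (3 * q)).+1 = 3 * (2 * q) + 1 by lia.
by rewrite -[X in 'C(_, X)]addn0 dvd3_lucas // muln1.
Qed.

Lemma nz_odd1 q : nz_odd (3 * q + 1) = false.
Proof.
rewrite /nz_odd; have -> : (2 * (3 * q + 1)).+1 = 3 * (2 * q).+1 + 0 by lia.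
by rewrite dvd3_lucas // muln0.
Qed.

Lemma nz_odd2 q : nz_odd (3 * q + 2) = nz_odd q.
Proof.
rewrite /nz_odd; have -> : (2 * (3 * q + 2)).+1 = 3 * (2 * q).+1 + 2 by lia.
by rewrite dvd3_lucas // muln1.
Qed.

Lemma sum_mod3 (F : nat -> nat) (m : nat) :
  \sum_(0 <= j < 3 * m) F j =
  \sum_(0 <= q < m) (F (3 * q) + F (3 * q + 1) + F (3 * q + 2)).
Proof.
elim: m => [|m IHm]; first by rewrite muln0 !big_nil.
by rewrite mulnS add3n !big_nat_recr //= IHm addn1 addn2 !addnA.
Qed.

Lemma count_nz_even k : \sum_(0 <= m < 3 ^ k) nz_even m = 2 ^ k.
Proof.
elim: k => [|k IHk]; first by rewrite big_nat1.
rewrite expnS sum_mod3 expnS mul2n -addnn -IHk -big_split /=.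
by apply: eq_bigr => q _; rewrite nz_even0 nz_even1 nz_even2 addn0.
Qed.

(** Last digit 0 contributes the count for [nz_even], last digit 2 that for [nz_odd]. *)
Lemma count_nz_odd k : \sum_(0 <= m < 3 ^ k) nz_odd m = 2 ^ k.
Proof.
elim: k => [|k IHk]; first by rewrite big_nat1.
rewrite expnS sum_mod3 expnS mul2n -addnn -{2}IHk -count_nz_even -big_split /=.
by apply: eq_bigr => q _; rewrite nz_odd0 nz_odd1 nz_odd2 addn0.
Qed.

Lemma count_motzkin N k : N < 3 ^ k ->
  \sum_(0 <= n < N) ~~ (3 %| motzkin n) <= 2 ^ k.+1.
Proof.
move=> Nk; rewrite expnS mul2n -addnn -{1}count_nz_even -count_nz_odd -big_split /=.
apply: (@leq_trans (\sum_(0 <= m < N.+1) (nz_even m + nz_odd m))).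
  (* The term m = 0 is dropped, so that m = n + 1 matches the index shift in [dvd3_motzkin]. *)
  rewrite big_nat_recl // [leqRHS]addnC; apply: leq_trans (leq_addr _ _).
  apply: leq_sum => n _; rewrite dvd3_motzkin.
  by have := @ndvd3_catalan n.+1; case: (3 %| _) => // /(_ isT); do 2 case: (_ n.+1).
by rewrite [leqRHS](big_cat_nat (n := N.+1)) //= leq_addr.
Qed.

(** * Passage to the density *)

Local Open Scope classical_set_scope.
Local Open Scope ring_scope.

Theorem theorem8 (R : realType) :
  has_asymptotic_density [set n : nat | (motzkin n = 0 %[mod 3])%N] (1 : R).
Proof.
rewrite /has_asymptotic_density.
(* With t the logarithm, c + 1 <= 4 * 2^t + 1 <= 5 * 2^t and 3^t <= N + 1 <= 2N give (c + 1) / N <=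
   10 (2/3)^t, where c counts the n <= N with M_n prime to 3. *)
pose u N : R := 10 * (2 / 3) ^+ trunc_log 3 N.+1.
have u0 : u N @[N --> \oo] --> 0.
  rewrite -[0](mulr0 10); apply: cvgM; first exact: cvg_cst.
  have h : trunc_log 3 N.+1 @[N --> \oo] --> \oo.
    apply/cvgnyPge => A; near=> N; apply: trunc_log_max => //.
    by apply: leqW; near: N; apply: nbhs_infty_ge.
  apply: (cvg_comp _ (fun k => (2 / 3) ^+ k) h); apply: cvg_expr; rewrite ger0_norm; lra.
apply: (@squeeze_cvgr _ _ _ _ (fun N => 1 - u N) (fun N => 1 + u N)); last 2 first.
- by rewrite -[X in _ --> X]subr0; apply: cvgB => //; apply: cvg_cst.
- by rewrite -[X in _ --> X]addr0; apply: cvgD => //; apply: cvg_cst.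
near=> N.
have N0 : (0 < N)%N by near: N; apply: nbhs_infty_gt.
set t := trunc_log 3 N.+1.
set c := (\sum_(0 <= n < N.+1) ~~ (3 %| motzkin n))%N.
have cle : (c <= 2 ^ t.+2)%N by apply: count_motzkin; apply: trunc_log_ltn.
have tN : (3 ^ t <= N.+1)%N by apply: trunc_logP.
have -> : #|[pred n : 'I_N.+1 |
    (n : nat) \in [set n : nat | (motzkin n = 0 %[mod 3])%N]]|%:R
    = N.+1%:R - c%:R :> R.
  apply/eqP; rewrite eq_sym subr_eq -natrD eqr_nat; apply/eqP.
  rewrite /c big_mkord -sum1_card big_mkcond -big_split /= -[LHS]card_ord -sum1_card.
  apply: eq_bigr => n _; rewrite inE /=.
  rewrite (_ : ((n : nat) \in _) = (3 %| motzkin n)%N); first by case: (_ %| _)%N.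
  by apply/idP/idP => [|/eqP h]; [rewrite inE => /eqP | rewrite inE].
have N0' : 0 < N%:R :> R by rewrite ltr0n.
have U : (c%:R + 1) / N%:R <= u N.
  rewrite ler_pdivrMr // /u -/t.
  have : 3 ^+ t <= 2 * N%:R :> R by rewrite -natrX -natrM ler_nat; lia.
  have : c%:R <= 4 * 2 ^+ t :> R by rewrite -natrX -natrM ler_nat -(expnD 2 2).
  have : 1 <= 2 ^+ t :> R by rewrite -natrX ler1n expn_gt0.
  rewrite expr_div_n; move: (2 ^+ t) => x x1 cx.
  have : 0 < 3 ^+ t :> R by rewrite exprn_gt0.
  move: (3 ^+ t) => y y0 yN.
  rewrite (_ : 10 * (x / y) * N%:R = 10 * x * N%:R / y); last by field; lra.
  rewrite ler_pdivlMr //.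
  by nra.
(* The range 0..N has N + 1 elements but is divided by N; the extra 1 is absorbed by |1 - c| <= c +
   1. *)
have -> : N%:R^-1 * (N.+1%:R - c%:R) = 1 + (1 - c%:R) / N%:R :> R.
  by rewrite -natr1; field; lra.
have c0 : 0 <= c%:R :> R by [].
have : - ((c%:R + 1) / N%:R) <= (1 - c%:R) / N%:R :> R.
  by rewrite -mulNr ler_pM2r ?invr_gt0 //; lra.
have : (1 - c%:R) / N%:R <= (c%:R + 1) / N%:R :> R.
  by rewrite ler_pM2r ?invr_gt0 //; lra.
by move=> *; apply/andP; split; lra.
Unshelve. all: by end_near.
Qed.
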